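(* Let $V$ be a complex Hilbert space of infinite dimension and let $a:V\times V\to\mathbb{C}$ be a continuous sesquilinear form. The following assertions are equivalent: (i) the form $a$ is essentially positive-coercive; (ii) there exist a finite dimensional subspace $V_1$ of $V$ and $\alpha>0$ such that $\operatorname{Re} a(u,u)\ge\alpha\|u\|_V^2$ for all $u\in V_1^\perp$; (iii) there exist a finite rank operator $K:V\to V'$ and $\alpha>0$ such that $\operatorname{Re}(a(u,u)+\langle Ku,u\rangle)\ge\alpha\|u\|_V^2$ for all $u\in V$; (iv) there exist a compact operator $K:V\to V'$ and $\alpha>0$ such that $\operatorname{Re}(a(u,u)+\langle Ku,u\rangle)\ge\alpha\|u\|_V^2$ for all $u\in V$; (v) there exist a Hilbert space $Y$, a compact operator $K:V\to Y$ and $\alpha>0$ such that $\operatorname{Re}(a(u,u)+\|Ku\|_Y^2)\ge\alpha\|u\|_V^2$ for all $u\in V$.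
   Context: The form $a$ is essentially positive-coercive if, for every sequence $(u_n)$ in $V$, the conditions $u_n\rightharpoonup 0$ weakly in $V$ and $\limsup_{n\to\infty}\operatorname{Re} a(u_n,u_n)\le 0$ imply $\|u_n\|_V\to 0$. $V'$ denotes the antidual of $V$ (bounded conjugate-linear functionals) and $\langle\cdot,\cdot\rangle$ the duality pairing between $V'$ and $V$, so that $(u,v)\mapsto\langle Ku,v\rangle$ is sesquilinear for linear $K:V\to V'$. Finite rank and compact operators are bounded linear operators. *)

(* Defs.v *)
From HB Require Import structures.
From mathcomp Require Import all_boot all_order all_algebra.
From mathcomp Require Import sesquilinear complex.
From mathcomp Require Import all_classical all_reals all_analysis.

Set Implicit Arguments.
Unset Strict Implicit.
Unset Printing Implicit Defensive.

Import Order.TTheory GRing.Theory Num.Theory.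
Import numFieldNormedType.Exports.
Import complex.

Local Open Scope classical_set_scope.
Local Open Scope complex_scope.
Local Open Scope ring_scope.

(* The norm of a normed module over [R[i]] takes its values in the nonnegative
   reals of [R[i]]; [rnorm] is the same norm, as an element of [R]. *)
Definition rnorm (R : realType) (E : normedModType R[i]) (u : E) : R :=
  Re `|u|.

Definition closed_unit_ball (R : realType) (E : normedModType R[i]) : set E :=
  [set u | rnorm u <= 1].
Arguments closed_unit_ball {R} E.

(* Forms and inner products are linear in the first argument and
   conjugate-linear in the second one. *)
Notation sesquilinear_form R V :=
  {bilinear V -> V -> R[i] | *%R & (Num.conj \; *%R)}.

HB.mixin Record isHilbert (R : realType) V & CompleteNormedModule R[i] V := {
  inner : {dot V for @Num.conj R[i]};
  normr_inner : forall u : V, `|u| ^+ 2 = inner u u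
}.

#[short(type="hilbertType")]
HB.structure Definition Hilbert (R : realType) :=
  {V of CompleteNormedModule R[i] V & isHilbert R V}.

Section BoundedMaps.
Variables (R : realType) (V E : normedModType R[i]).

Definition bounded_map (f : V -> E) : Prop :=
  exists M : R, forall u, rnorm (f u) <= M * rnorm u.

Definition finite_dim_subspace (A : set V) : Prop :=
  exists (n : nat) (e : 'I_n -> V),
    A = [set u | exists c : 'I_n -> R[i], u = \sum_(i < n) c i *: e i].

End BoundedMaps.

Definition infinite_dimensional (R : realType) (V : normedModType R[i]) : Prop :=
  ~ finite_dim_subspace [set: V].

Section Operators.
Variables (R : realType) (V E : normedModType R[i]).

Definition finite_rank_operator (K : {linear V -> E}) : Prop :=
  bounded_map K /\ finite_dim_subspace (range K).

Definition compact_operator (K : {linear V -> E}) : Prop :=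
  bounded_map K /\ precompact (K @` closed_unit_ball V).

End Operators.

Section Rnorm.
Variables (R : realType) (E : normedModType R[i]).
Implicit Types u v : E.

Lemma rnormE u : `|u| = (rnorm u)%:C.
Proof. by rewrite /rnorm RRe_real // ger0_real. Qed.

Lemma rnorm_ge0 u : 0 <= rnorm u.
Proof. by rewrite -lecR -rnormE normr_ge0. Qed.

Lemma rnorm0 : rnorm (0 : E) = 0.
Proof. by rewrite /rnorm normr0. Qed.

Lemma rnormD u v : rnorm (u + v) <= rnorm u + rnorm v.
Proof. by rewrite -lecR rmorphD /= -!rnormE ler_normD. Qed.

Lemma rnormZ (c : R[i]) u : rnorm (c *: u) = Re `|c| * rnorm u.
Proof.
suff : (rnorm (c *: u))%:C = (Re `|c| * rnorm u)%:C
  by move/(congr1 (@complex.Re R)).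
by rewrite rmorphM /= -!rnormE normrZ.
Qed.

Lemma rnorm_eq0 u : rnorm u = 0 -> u = 0.
Proof. by move=> u0; apply/normr0_eq0; rewrite rnormE u0. Qed.

End Rnorm.

Section Antidual.
Variables (R : realType) (V : normedModType R[i]).

Definition antilinear (f : V -> R[i]^o) : Prop :=
  forall (c : R[i]) (u v : V), f (c *: u + v) = c^* *: f u + f v.

Definition is_antifunctional : {pred V -> R[i]^o} :=
  [pred f | `[< antilinear f /\ bounded_map f >]].

Record antidual := Antidual {
  antifun :> V -> R[i]^o;
  antifunP : antifun \in is_antifunctional
}.

HB.instance Definition _ := [isSub for antifun].
HB.instance Definition _ := [Choice of antidual by <:].

Lemma is_antifunctional_submod : submod_closed is_antifunctional.
Proof.
split=> [|c f g /asboolP[fl [M fM]] /asboolP[gl [N gN]]].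
  apply/asboolP; split=> [c u v|]; first by rewrite /= scaler0 addr0.
  by exists 0 => u; rewrite rnorm0 mul0r.
apply/asboolP; split=> [d u v|].
  by rewrite !fctE fl gl !scalerDr addrACA !scalerA mulrC.
exists (Re `|c| * M + N) => u; rewrite !fctE.
apply: le_trans (rnormD _ _) _; rewrite mulrDl lerD ?gN//.
by rewrite rnormZ -mulrA ler_wpM2l //; exact: (rnorm_ge0 (c : R[i]^o)).
Qed.

HB.instance Definition _ := GRing.isSubmodClosed.Build _ _
  is_antifunctional is_antifunctional_submod.
HB.instance Definition _ := [SubChoice_isSubLmodule of antidual by <:].

Definition antidual_norm (f : antidual) : R :=
  sup [set rnorm (f v) | v in closed_unit_ball V].

Let antidual_set (f : antidual) := [set rnorm (f v) | v in closed_unit_ball V].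

Lemma antifunZ (f : antidual) (c : R[i]) v : f (c *: v) = c^* *: f v.
Proof.
have /asboolP[fl _] := antifunP f.
have f0 : f 0 = 0.
  have := fl 1 0 0; rewrite scaler0 addr0 rmorph1 scale1r => /eqP.
  by rewrite -subr_eq0 opprD addNKr oppr_eq0 => /eqP.
by have := fl c v 0; rewrite !addr0 f0 addr0.
Qed.

Lemma has_sup_antidual (f : antidual) : has_sup (antidual_set f).
Proof.
have /asboolP[_ [M fM]] := antifunP f.
split; first by exists (rnorm (f 0)), 0 => //=; rewrite /closed_unit_ball /= rnorm0.
exists `|M| => _ [v v1 <-]; apply: le_trans (fM v) _.
apply: le_trans (ler_wpM2r (rnorm_ge0 v) (ler_norm M)) _.
by rewrite ler_piMr.
Qed.

Lemma antidual_norm_ge (f : antidual) v :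
  rnorm v <= 1 -> rnorm (f v) <= antidual_norm f.
Proof.
by move=> v1; apply: (ub_le_sup (has_sup_antidual f).2); exists v.
Qed.

Lemma antidual_norm_le (f : antidual) (M : R) :
  (forall v, rnorm v <= 1 -> rnorm (f v) <= M) -> antidual_norm f <= M.
Proof.
move=> fM; apply: ge_sup; first exact: (has_sup_antidual f).1.
by move=> _ [v v1 <-]; exact: fM.
Qed.

Lemma antidual_norm_ge0 (f : antidual) : 0 <= antidual_norm f.
Proof.
by apply: le_trans (rnorm_ge0 (f 0)) (antidual_norm_ge _ _); rewrite rnorm0.
Qed.

Lemma antidual_norm0_eq0 (f : antidual) : antidual_norm f = 0 -> f = 0.
Proof.
move=> f0; apply/val_inj/funext => v /=.
have [->|v0] := eqVneq v 0.
  by have := antifunZ f 0 0; rewrite scale0r rmorph0 scale0r.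
have rv0 : rnorm v != 0 by apply: contra_neq v0 => /rnorm_eq0.
pose c := ((rnorm v)^-1)%:C : R[i].
have c0 : c^* != 0 by rewrite fmorph_eq0 fmorph_eq0 invr_eq0.
have cv1 : rnorm (c *: v) <= 1.
  rewrite rnormZ (_ : `|c| = c); first by rewrite /= mulVf.
  by rewrite ger0_norm // lecR invr_ge0 rnorm_ge0.
have /eqP : f (c *: v) = 0.
  by apply/rnorm_eq0/le_anti; rewrite rnorm_ge0 -f0 antidual_norm_ge.
by rewrite antifunZ scaler_eq0 (negPf c0) => /eqP.
Qed.

Lemma antidual_normD (f g : antidual) :
  antidual_norm (f + g) <= antidual_norm f + antidual_norm g.
Proof.
apply: antidual_norm_le => v v1.
by apply: le_trans (rnormD _ _) _; rewrite lerD ?antidual_norm_ge.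
Qed.

Lemma antidual_normZ_le (c : R[i]) (f : antidual) :
  antidual_norm (c *: f) <= Re `|c| * antidual_norm f.
Proof.
apply: antidual_norm_le => v v1.
apply: le_trans (_ : Re `|c| * rnorm (f v) <= _); first by rewrite -rnormZ.
by rewrite ler_wpM2l ?antidual_norm_ge //; exact: (rnorm_ge0 (c : R[i]^o)).
Qed.

Lemma antidual_normZ (c : R[i]) (f : antidual) :
  antidual_norm (c *: f) = Re `|c| * antidual_norm f.
Proof.
have [->|c0] := eqVneq c 0.
  rewrite normr0 mul0r; apply/le_anti.
  by rewrite antidual_norm_ge0 andbT (le_trans (antidual_normZ_le _ _)) ?normr0 ?mul0r.
have Rc0 : 0 < Re `|c| by rewrite -ltcR RRe_real ?normr_real // normr_gt0.
have RcV : Re `|c^-1| = (Re `|c|)^-1.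
  suff : (Re `|c^-1|)%:C = ((Re `|c|)^-1)%:C :> R[i] by move/(congr1 (@complex.Re R)).
  by rewrite fmorphV !RRe_real ?normr_real // normfV.
apply/le_anti; rewrite antidual_normZ_le /= -ler_pdivlMl // -RcV.
by apply: le_trans (antidual_normZ_le _ _); rewrite scalerA mulVf // scale1r.
Qed.

Let antidual_normC (f : antidual) : R[i] := (antidual_norm f)%:C.

Let antidual_normCD (f g : antidual) :
  antidual_normC (f + g) <= antidual_normC f + antidual_normC g.
Proof. by rewrite -rmorphD lecR antidual_normD. Qed.

Let antidual_normCZ (c : R[i]) (f : antidual) :
  antidual_normC (c *: f) = `|c| * antidual_normC f.
Proof.
by rewrite /antidual_normC antidual_normZ rmorphM.
Qed.

Let antidual_normC0 (f : antidual) : antidual_normC f = 0 -> f = 0.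
Proof. by move/(congr1 (@complex.Re R)) => /= /antidual_norm0_eq0. Qed.

HB.instance Definition _ := @Lmodule_isNormed.Build R[i] antidual
  antidual_normC antidual_normCD antidual_normCZ antidual_normC0.

End Antidual.

Section EssentiallyPositiveCoercive.
Variables (R : realType) (V : normedModType R[i]).

Definition weakly_converges (u : nat -> V) (l : V) : Prop :=
  forall phi : {linear V -> R[i]^o}, bounded_map phi ->
    phi (u n) @[n --> \oo] --> phi l.

Definition essentially_positive_coercive (a : sesquilinear_form R V) : Prop :=
  forall u : nat -> V,
    weakly_converges u 0 ->
    (limn_esup (fun n => (Re (a (u n) (u n)))%:E) <= 0)%E ->
    rnorm (u n) @[n --> \oo] --> 0.

End EssentiallyPositiveCoercive.

Definition continuous_form (R : realType) (V : normedModType R[i])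
    (a : sesquilinear_form R V) : Prop :=
  continuous (fun p : V * V => a p.1 p.2 : R[i]^o).

Definition orthogonal_complement (R : realType) (V : hilbertType R)
    (A : set V) : set V :=
  [set u | forall v, A v -> inner u v = 0].

(* Main.v *)
(* Each of (iii), (iv), (v) says that [Re a + b] is coercive, where [b] tends to
   [0] along bounded weakly null sequences because a compact operator maps them
   to norm-null sequences; dividing [u_n] by [max 1 |u_n|] reduces (i) to
   bounded sequences.  Conversely, if (ii) fails, an orthonormal sequence with
   [Re a(u_n, u_n) < 1 / (n + 1)] can be picked greedily; it is weakly null by
   Bessel's inequality, which contradicts (i).  Finally, if [P] is the
   orthogonal projection onto [V1] in (ii), then [Re a(u, u) + lam * |P u|^2] is
   coercive for [lam] large, which gives (iii) with [K u = lam * <P u, _>] and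
   (v) with [Y = V] and [K = sqrt lam * P]. *)

From HB Require Import structures.
Require Import Defs.
From mathcomp Require Import all_boot all_order all_algebra.
From mathcomp Require Import sesquilinear complex.
From mathcomp Require Import all_classical all_reals all_analysis.
From mathcomp Require Import ring lra.

Set Implicit Arguments.
Unset Strict Implicit.
Unset Printing Implicit Defensive.

Import Order.TTheory GRing.Theory Num.Theory.
Import numFieldNormedType.Exports.
Import complex.

Local Open Scope classical_set_scope.
Local Open Scope complex_scope.
Local Open Scope ring_scope.

(** * Normalization of nonzero vectors *)

Section Rnorm.
Variables (R : realType) (E : normedModType R[i]).
Implicit Types u : E.

Lemma rnorm_gt0 u : u != 0 -> 0 < rnorm u.
Proof.
move=> u0; rewrite lt_neqAle rnorm_ge0 andbT eq_sym.
by apply: contra_neq u0; exact: rnorm_eq0.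
Qed.

Lemma rnormZr_unit u : u != 0 -> rnorm ((rnorm u)^-1%:C *: u) = 1.
Proof.
move=> /rnorm_gt0 u0; rewrite rnormZ ger0_norm ?lecR ?invr_ge0 ?(ltW u0) //=.
by rewrite mulVf // gt_eqF.
Qed.

End Rnorm.

(** * Orthonormal lists, projections, Bessel and Gram-Schmidt *)

Section HilbertBasics.
Variables (R : realType) (V : hilbertType R).
Implicit Types (u v w : V) (s : seq V).

Lemma inner_conj u v : inner u v = (inner v u)^*%R.
Proof. by rewrite hermC /= expr0 mul1r. Qed.

Lemma innerZl (c : R[i]) u v : inner (c *: u) v = c * inner u v.
Proof. exact: linearZl_LR. Qed.

Lemma innerZr (c : R[i]) u v : inner u (c *: v) = (c^*)%R * inner u v.
Proof. exact: linearZr_LR. Qed.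

Lemma inner_rnorm u : inner u u = (rnorm u ^+ 2)%:C.
Proof. by rewrite -normr_inner rnormE rmorphXn. Qed.

Lemma inner_eq0_sym u v : inner u v = 0 -> inner v u = 0.
Proof. by move=> uv; rewrite inner_conj uv rmorph0. Qed.

Lemma rnorm_pythagoras u v :
  inner u v = 0 -> rnorm (u + v) ^+ 2 = rnorm u ^+ 2 + rnorm v ^+ 2.
Proof.
move=> uv; apply: (@complexI R).
by rewrite rmorphD /= -!inner_rnorm hnormDd.
Qed.

Lemma rnorm_sqr_mulC (z : R[i]^o) : (rnorm z ^+ 2)%:C = z * (z : R[i])^*%R.
Proof. by rewrite rmorphXn /= -rnormE normCK. Qed.

(** The orthogonal projection onto the span of [s] once [s] is orthonormal; linear in [u] for every
    list. *)
Definition proj s u : V := \sum_(e <- s) inner u e *: e.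

Lemma proj_is_linear s : linear (proj s).
Proof.
move=> c u v; rewrite /proj scaler_sumr -big_split; apply: eq_bigr => e _ /=.
by rewrite linearDl /= innerZl scalerDl scalerA.
Qed.

HB.instance Definition _ s := GRing.isLinear.Build R[i] V V _ (proj s)
  (proj_is_linear s).

Section Orthonormal.
Variable s : seq V.
Hypothesis s_on : orthonormal inner s.

Lemma inner_sum_orthonormal (c : V -> R[i]) e :
  e \in s -> inner (\sum_(f <- s) c f *: f) e = c e.
Proof.
have [us os] := orthonormalP s_on; move=> es.
rewrite linear_sumlz (bigD1_seq e) //= big1_seq ?addr0 => [|f /andP[fe fs]].
  by rewrite innerZl os // eqxx mulr1.
by rewrite innerZl os // (negPf fe) mulr0.
Qed.

Lemma inner_proj u e : e \in s -> inner (proj s u) e = inner u e.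
Proof. exact: inner_sum_orthonormal. Qed.

Lemma proj_compl_orthogonal u e : e \in s -> inner (u - proj s u) e = 0.
Proof. by move=> es; rewrite linearBl /= inner_proj // subrr. Qed.

Lemma proj_compl_proj u v : inner (u - proj s u) (proj s v) = 0.
Proof.
rewrite /proj linear_sumr /= big1_seq // => e /andP[_ es].
by rewrite innerZr proj_compl_orthogonal // mulr0.
Qed.

Lemma rnorm_sum_orthonormal (c : V -> R[i]^o) :
  rnorm (\sum_(e <- s) c e *: e) ^+ 2 = \sum_(e <- s) rnorm (c e) ^+ 2.
Proof.
apply: (@complexI R); rewrite -inner_rnorm linear_sumr /= rmorph_sum /=.
apply: eq_big_seq => e es.
by rewrite rnorm_sqr_mulC innerZr inner_sum_orthonormal // mulrC.
Qed.

Lemma rnorm_proj_sqr u :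
  rnorm (proj s u) ^+ 2 = \sum_(e <- s) rnorm (inner u e : R[i]^o) ^+ 2.
Proof. exact: rnorm_sum_orthonormal. Qed.

Lemma rnorm_sqr_proj u :
  rnorm u ^+ 2 = rnorm (proj s u) ^+ 2 + rnorm (u - proj s u) ^+ 2.
Proof.
by rewrite addrC -rnorm_pythagoras ?subrK // proj_compl_proj.
Qed.

(** Later turns the pairing of [P u] with [u] in (iii) into the penalty |P u|^2. *)
Lemma inner_proj_self u : inner (proj s u) u = (rnorm (proj s u) ^+ 2)%:C.
Proof.
rewrite -inner_rnorm -{2}(subrK (proj s u) u) linearDr /=.
by rewrite (inner_eq0_sym (proj_compl_proj _ _)) add0r.
Qed.

Lemma rnorm_proj_le u : rnorm (proj s u) <= rnorm u.
Proof.
rewrite -(ler_pXn2r (ltn0Sn 1)) ?nnegrE ?rnorm_ge0 //.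
by rewrite (rnorm_sqr_proj u) lerDl sqr_ge0.
Qed.

Lemma proj_id e : e \in s -> proj s e = e.
Proof.
have [us os] := orthonormalP s_on; move=> es.
rewrite /proj (bigD1_seq e) //= big1_seq ?addr0 => [|f /andP[fe fs]].
  by rewrite os // eqxx scale1r.
by rewrite os // eq_sym (negPf fe) scale0r.
Qed.

Lemma orthonormal_cons e :
  rnorm e = 1 -> (forall f, f \in s -> inner e f = 0) ->
  orthonormal inner (e :: s).
Proof.
move=> e1 es; move: s_on => /andP[s1 s2]; rewrite /orthonormal /= s1 s2 !andbT.
rewrite inner_rnorm e1 expr1n eqxx /=.
by apply/allP => f fs /=; apply/eqP; exact: es.
Qed.

(* Bounds the values of a bounded functional on [s], by testing it on
   [\sum_e conj (phi e) e]; no Riesz representation is needed. *)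
Lemma bessel_functional (phi : {linear V -> R[i]^o}) (M : R) :
  (forall u, rnorm (phi u) <= M * rnorm u) ->
  \sum_(e <- s) rnorm (phi e) ^+ 2 <= M ^+ 2.
Proof.
move=> phiM; set S := \sum_(e <- s) _.
have S0 : 0 <= S by apply: sumr_ge0 => e _; exact: sqr_ge0.
pose x := \sum_(e <- s) ((phi e : R[i])^*%R : R[i]^o) *: e.
have nx : rnorm x ^+ 2 = S.
  rewrite rnorm_sum_orthonormal; apply: eq_bigr => e _; congr (_ ^+ 2).
  by rewrite /rnorm norm_conjC.
have px : phi x = S%:C.
  rewrite /x linear_sum rmorph_sum /=; apply: eq_bigr => e _.
  by rewrite linearZ /= rnorm_sqr_mulC mulrC.
have npx : rnorm (phi x) = S by rewrite px /rnorm ger0_norm // lecR.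
have [->|Sn0] := eqVneq S 0; first exact: sqr_ge0.
have Sgt0 : 0 < S by rewrite lt_neqAle eq_sym Sn0.
have : S ^+ 2 <= M ^+ 2 * S.
  rewrite -[X in _ <= _ * X]nx -exprMn -npx lerXn2r ?nnegrE ?rnorm_ge0 //.
  exact: le_trans (rnorm_ge0 (phi x)) (phiM x).
by rewrite expr2 ler_pM2r.
Qed.

End Orthonormal.

(** Bessel's inequality for the one-element list made of [v / rnorm v]. *)
Lemma cauchy_schwarz u v : rnorm (inner u v : R[i]^o) <= rnorm u * rnorm v.
Proof.
have [->|v0] := eqVneq v 0.
  by rewrite linear0r rnorm0 mulr_ge0 ?rnorm_ge0.
pose e := (rnorm v)^-1%:C *: v.
have on : orthonormal inner [:: e].
  by apply: orthonormal_cons => //; exact: rnormZr_unit.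
have vE : v = (rnorm v)%:C *: e.
  by rewrite scalerA -rmorphM /= divff ?scale1r // gt_eqF ?rnorm_gt0.
have : rnorm (inner u e : R[i]^o) <= rnorm u.
  rewrite -(ler_pXn2r (ltn0Sn 1)) ?nnegrE ?rnorm_ge0 //.
  rewrite (rnorm_sqr_proj on u) rnorm_proj_sqr // big_seq1 lerDl sqr_ge0 //.
move=> ue; rewrite {1}vE innerZr -[_ * inner _ _]/(_ *: (inner u e : R[i]^o)).
rewrite rnormZ mulrC norm_conjC ger0_norm ?lecR ?rnorm_ge0 //=.
by rewrite ler_wpM2r ?rnorm_ge0.
Qed.

(** Spans are compared through their orthogonal complements, the form in which (ii) is applied to
    [u - proj t u]. Each new vector contributes its normalized residual, or nothing when the
    residual vanishes. *)
Lemma gram_schmidt s : exists2 t, orthonormal inner t &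
  forall u, (forall e, e \in t -> inner u e = 0) ->
            forall x, x \in s -> inner u x = 0.
Proof.
elim: s => [|x s [t ton tP]]; first by exists [::].
pose y := x - proj t x.
have xE u : (forall e, e \in t -> inner u e = 0) -> inner u x = inner u y.
  move=> ut; rewrite -[x in LHS](subrK (proj t x)) -/y linearDr /=.
  rewrite /proj linear_sumr /= big1_seq ?addr0 // => e /andP[_ et].
  by rewrite innerZr ut // mulr0.
have [y0|y0] := eqVneq y 0.
  exists t => // u ut z; rewrite inE => /predU1P[->|]; last exact: tP.
  by rewrite xE // y0 linear0r.
exists ((rnorm y)^-1%:C *: y :: t).
  apply: orthonormal_cons => // [|f ft]; first exact: rnormZr_unit.
  by rewrite innerZl proj_compl_orthogonal // mulr0.
move=> u ut; have ut' e : e \in t -> inner u e = 0.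
  by move=> et; apply: ut; rewrite inE et orbT.
move=> z; rewrite inE => /predU1P[->|]; last exact: tP.
rewrite xE //; have := ut _ (mem_head _ _); rewrite innerZr => /eqP.
rewrite mulf_eq0 fmorph_eq0 fmorph_eq0 invr_eq0 gt_eqF ?rnorm_gt0 //=.
by move/eqP.
Qed.

End HilbertBasics.

(** * Null sequences and limits superior with real tolerances *)

Section Convergence.
Variable R : realType.

(** Radii of balls are elements of [R[i]]; a positive one is real, so real tolerances suffice. *)
Lemma cvg0_rnormP (E : normedModType R[i]) (u : nat -> E) :
  u n @[n --> \oo] --> (0 : E) <->
  forall e : R, 0 < e -> \forall n \near \oo, rnorm (u n) < e.
Proof.
split=> [/cvgrPdist_lt u0 e e0|u0].
  have := u0 e%:C; rewrite ltcR => /(_ e0); apply: filterS => n.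
  by rewrite sub0r normrN rnormE ltcR.
apply/cvgrPdist_lt => e e0.
have eE : e = (complex.Re e)%:C by rewrite RRe_real // gtr0_real.
have := u0 (complex.Re e); rewrite -ltcR -eE => /(_ e0); apply: filterS => n.
by rewrite -ltcR -eE sub0r normrN -rnormE.
Qed.

Lemma cvg0_ge0P (x : nat -> R) : (forall n, 0 <= x n) ->
  (x n @[n --> \oo] --> (0 : R) <->
   forall e : R, 0 < e -> \forall n \near \oo, x n < e).
Proof.
move=> x0; split=> [/cvgrPdist_lt xl e e0|xl].
  have := xl e e0; apply: filterS => n.
  by rewrite sub0r normrN ger0_norm.
apply/cvgrPdist_lt => e e0; have := xl e e0; apply: filterS => n.
by rewrite sub0r normrN ger0_norm.
Qed.

(** The limit superior is the infimum, over the sets of the filter, of suprema; the set where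
    [x n < e] bounds this infimum by [e]. *)
Lemma limn_esup_le0P (x : nat -> R) :
  (limn_esup (fun n => (x n)%:E) <= 0)%E <->
  forall e : R, 0 < e -> \forall n \near \oo, x n < e.
Proof.
rewrite /limn_esup limf_esupE; split=> [xl e e0|xl].
  have : (ereal_inf [set ereal_sup ((fun n => (x n)%:E) @` A) | A in \oo]
          < e%:E)%E.
    by apply: le_lt_trans xl _; rewrite lte_fin.
  move=> /ereal_inf_lt[_ [A Aoo <-] Ae].
  apply: filterS Aoo => n An; rewrite -lte_fin; apply: le_lt_trans Ae.
  by apply: ereal_sup_ubound; exists n.
apply/lee_addgt0Pr => e e0; rewrite add0e.
apply: (@le_trans _ _ (ereal_sup
  ((fun n => (x n)%:E) @` [set n | x n < e]))).
  by apply: ereal_inf_lbound; exists [set n | x n < e] => //; exact: xl.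
by apply: ge_ereal_sup => _ [n /= xn <-]; rewrite lee_fin ltW.
Qed.

Lemma Re_ler_rnorm (z : R[i]^o) : `|complex.Re (z : R[i])| <= rnorm z.
Proof. by rewrite -lecR -rnormE normc_ge_Re. Qed.

Lemma ReD (x y : R[i]) :
  complex.Re (x + y) = complex.Re x + complex.Re y.
Proof. by case: x y => [? ?] [? ?]. Qed.

Lemma ReZr (c : R) (z : R[i]) : complex.Re (c%:C * z) = c * complex.Re z.
Proof. by case: z => x y /=; rewrite mul0r subr0. Qed.

End Convergence.

(** * Boundedness of continuous sesquilinear forms *)

Section Forms.
Variables (R : realType) (V : normedModType R[i]).

Lemma form_scale (a : sesquilinear_form R V) (c d : R) u v :
  a (c%:C *: u) (d%:C *: v) = (c * d)%:C * a u v.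
Proof.
rewrite linearZl_LR linearZr_LR /= mulrA rmorphM /=; congr (_ * _ * _).
by rewrite conj_Creal // complex_real.
Qed.

(** Continuity at the origin gives [|a u v| < 1] when both norms are at most [d]; rescaling both
    arguments to norm [d] yields the constant [d ^- 2]. *)
Lemma continuous_form_bounded (a : sesquilinear_form R V) :
  continuous_form a ->
  exists2 M : R, 0 <= M &
    forall u v, rnorm (a u v : R[i]^o) <= M * rnorm u * rnorm v.
Proof.
move=> ac; have /cvgrPdist_lt/(_ 1 ltr01) := ac (0, 0).
rewrite /= linear0l => /nbhs_ballP[e /= e0 ae].
(* Half the radius, so that the closed ball of radius [d] lies in the open ball of radius [e]. *)
pose d := complex.Re e / 2.
have eE : e = (complex.Re e)%:C by rewrite RRe_real // gtr0_real.
have Re0 : 0 < complex.Re e by rewrite -ltcR -eE.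
have d0 : 0 < d by rewrite divr_gt0.
have small u : rnorm u <= d -> ball (0 : V) e u.
  move=> ud; rewrite -ball_normE /= sub0r normrN rnormE eE ltcR.
  by apply: le_lt_trans ud _; rewrite ltr_pdivrMr // ltr_pMr // ltr1n.
have unit u v : rnorm u <= d -> rnorm v <= d -> rnorm (a u v : R[i]^o) < 1.
  move=> ud vd; have := ae (u, v) (conj (small u ud) (small v vd)).
  by rewrite /= sub0r normrN -ltcR -rnormE.
exists (d ^- 2) => [|u v]; first by rewrite invr_ge0 sqr_ge0.
have [->|u0] := eqVneq u 0; first by rewrite linear0l !rnorm0 mulr0 mul0r.
have [->|v0] := eqVneq v 0; first by rewrite linear0r !rnorm0 mulr0.
have nd (w : V) : w != 0 -> rnorm ((d / rnorm w)%:C *: w) <= d.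
  move=> /rnorm_gt0 w0; have dw := divr_gt0 d0 w0.
  rewrite rnormZ ger0_norm ?lecR ?(ltW dw) //=.
  by rewrite divfK // lt0r_neq0.
have := unit _ _ (nd _ u0) (nd _ v0); rewrite form_scale.
rewrite -[_ * a u v]/(_ *: (a u v : R[i]^o)) rnormZ.
have c0 : 0 < d / rnorm u * (d / rnorm v).
  by rewrite mulr_gt0 ?divr_gt0 ?rnorm_gt0.
rewrite ger0_norm ?lecR ?(ltW c0) //= -ltr_pdivlMl // mulr1.
move=> /ltW/le_trans; apply.
rewrite le_eqVlt; apply/orP; left; apply/eqP.
by field; rewrite !gt_eqF ?rnorm_gt0.
Qed.

End Forms.

(** * Evaluations on the antidual and coordinates of finite combinations *)

Section AntidualEvaluation.
Variables (R : realType) (V : normedModType R[i]).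

Definition antidual_eval (v : V) (f : antidual V) : R[i]^o := f v.

Lemma antidual_eval_is_linear v : linear (antidual_eval v).
Proof. by []. Qed.

HB.instance Definition _ v := GRing.isLinear.Build R[i] (antidual V) R[i]^o _
  (antidual_eval v) (antidual_eval_is_linear v).

Lemma antidual_ext (f g : antidual V) : (forall v, f v = g v) -> f = g.
Proof. by move=> fg; apply/val_inj/funext. Qed.

Lemma antidual_rnorm_le (f : antidual V) v :
  rnorm (f v) <= rnorm f * rnorm v.
Proof.
have [->|v0] := eqVneq v 0.
  have := antifunZ f 0 0; rewrite scale0r rmorph0 scale0r => ->.
  by rewrite !rnorm0 mulr0.
have vE : v = (rnorm v)%:C *: ((rnorm v)^-1%:C *: v).
  by rewrite scalerA -rmorphM /= divff ?scale1r // gt_eqF ?rnorm_gt0.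
rewrite {1}vE antifunZ rnormZ norm_conjC ger0_norm ?lecR ?rnorm_ge0 //=.
rewrite mulrC ler_wpM2r ?rnorm_ge0 //.
by apply: antidual_norm_ge; rewrite rnormZr_unit.
Qed.

Lemma antidual_eval_bounded v : bounded_map (antidual_eval v).
Proof. by exists (rnorm v) => f; rewrite mulrC; exact: antidual_rnorm_le. Qed.

(* The vectors [p.1] and antifunctionals [p.2] play the role of a dual basis,
   without the requirement of linear independence. *)
Lemma antidual_dual_family (I : Type) (r : seq I) (e : I -> antidual V) :
  exists ps : seq (V * antidual V), forall c : I -> R[i],
    let f := \sum_(i <- r) c i *: e i in
    f = \sum_(p <- ps) f p.1 *: p.2.
Proof.
elim: r => [|i r [ps IH]].
  by exists [::] => c /=; rewrite !big_nil.
pose T (f : antidual V) : antidual V := \sum_(p <- ps) f p.1 *: p.2.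
pose h : antidual V := e i - T (e i).
(* [T] is linear and fixes every combination over [r], so only the residual [h] of [e i] remains. *)
have TE c : let f := \sum_(j <- i :: r) c j *: e j in f = T f + c i *: h.
  rewrite /= big_cons; set g := \sum_(j <- r) _.
  have -> : T (c i *: e i + g) = c i *: T (e i) + g.
    have gT : g = T g := IH c.
    rewrite [in RHS]gT /T scaler_sumr -big_split; apply: eq_bigr => p _.
    by rewrite /= scalerA; exact: scalerDl.
  by rewrite /h scalerBr [RHS]addrC addrA subrK.
have [h0|[v hv]] : h = 0 \/ exists v, h v != 0.
  have [|hn] := pselect (exists v, h v != 0); first by right.
  left; apply: antidual_ext => v; apply: contrapT => /eqP hv.
  by apply: hn; exists v.
  by exists ps => c /=; rewrite [LHS]TE h0 scaler0 addr0.
(* The new pair reads off the coefficient of [h] at [v]; the old antifunctionals are corrected by a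
   multiple of [h] so as to vanish at [v]. *)
exists ((v, (h v)^-1 *: h) ::
  map (fun p : V * antidual V => (p.1, p.2 - ((p.2 v / h v : R[i]) *: h))) ps)
  => c /=.
set f := \sum_(j <- i :: r) _.
rewrite big_cons big_map /=.
under [X in _ + X]eq_bigr => p _ do rewrite scalerBr !scalerA mulrA.
rewrite big_split /= -/(T f) sumrN -scaler_suml -mulr_suml.
have -> : \sum_(p <- ps) f p.1 * p.2 v = T f v.
  by rewrite -[RHS]/(antidual_eval v (T f)) linear_sum.
rewrite [LHS]TE -/f scalerA [RHS]addrCA -scalerBl; congr (_ + _ *: _).
have -> : f v = T f v + c i * h v by rewrite {1}[f]TE.
by rewrite -mulrBl addrC addKr mulfK.
Qed.

End AntidualEvaluation.

(** * Compact operators and weakly null sequences *)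

Section Compactness.
Variable R : realType.

Lemma complex_continuous :
  continuous (fun p : R * R => p.1 +i* p.2 : R[i]^o).
Proof.
move=> [x y]; apply/cvgrPdist_lt => e e0.
have eE : e = (complex.Re e)%:C by rewrite RRe_real // gtr0_real.
have Re0 : 0 < complex.Re e / 2 by rewrite divr_gt0 // -ltcR -eE.
exists (ball x (complex.Re e / 2), ball y (complex.Re e / 2)).
  by split; exact: nbhsx_ballx.
move=> -[x' y'] [/= xx' yy'].
rewrite eE normc_def ltcR /=; set p := x - x'; set q := y - y'.
apply: (@le_lt_trans _ _ (`|p| + `|q|)).
  rewrite -[leRHS]ger0_norm ?addr_ge0 // -sqrtr_sqr ler_wsqrtr //.
  rewrite [leRHS]sqrrD !real_normK ?num_real // lerD2r lerDl.
  by rewrite mulrn_wge0 ?mulr_ge0.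
by rewrite [ltRHS]splitr ltrD.
Qed.

(** [D] is the image of the compact square [[-M, M]^2], which contains the disc. *)
Lemma disc_compact (M : R) : exists2 D : set R[i]^o, compact D &
  forall z, rnorm z <= M -> D z.
Proof.
exists ((fun p : R * R => p.1 +i* p.2 : R[i]^o) @` (`[-M, M] `*` `[-M, M])).
  apply: continuous_compact; last first.
    by apply: compact_setX; exact: segment_compact.
  exact/continuous_subspaceT/complex_continuous.
move=> [x y]; rewrite /rnorm normc_def /= => zM; exists (x, y) => //=.
by split; rewrite /= in_itv /= -ler_norml; apply: le_trans zM;
  rewrite -sqrtr_sqr ler_wsqrtr // ?lerDl ?lerDr sqr_ge0.
Qed.

Variable E : normedModType R[i].

(** By induction, the set is the continuous image of a product of two compact sets under
    [(z, y) |-> z *: f i + y]. *)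
Lemma compact_bounded_sums (I : Type) (r : seq I) (f : I -> E) (M : I -> R) :
  exists2 B : set E, compact B & forall c : I -> R[i]^o,
    (forall i, rnorm (c i) <= M i) -> B (\sum_(i <- r) c i *: f i).
Proof.
elim: r => [|i r [B cB BP]].
  by exists [set 0] => [|c _]; [exact: compact_set1|rewrite big_nil].
have [D cD DP] := disc_compact (M i).
exists ((fun p : R[i]^o * E => p.1 *: f i + p.2) @` (D `*` B)).
  apply: continuous_compact; last exact: compact_setX.
  apply: continuous_subspaceT => p; apply: cvgD; last exact: cvg_snd.
  by apply: cvgZ; [exact: cvg_fst|exact: cvg_cst].
move=> c cM; exists (c i, \sum_(j <- r) c j *: f j); last by rewrite big_cons.
by split => /=; [exact: DP|exact: BP].
Qed.

Variable V : normedModType R[i].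

Lemma compact_operator_sum (K : {linear V -> E}) (I : Type) (r : seq I)
    (c : V -> I -> R[i]^o) (f : I -> E) (M : I -> R) :
  bounded_map K -> (forall u, K u = \sum_(i <- r) c u i *: f i) ->
  (forall u i, rnorm u <= 1 -> rnorm (c u i) <= M i) -> compact_operator K.
Proof.
move=> Kb KE cM; split=> //.
have [B cB BP] := compact_bounded_sums r f M.
apply: (@precompact_subset _ _ B); last first.
  by apply: compact_precompact => //; exact: norm_hausdorff.
by move=> _ [u u1 <-]; rewrite KE; apply: BP => i; exact: cM.
Qed.

(** The consequence of Hahn-Banach used to identify weak limits; it is checked directly for
    antiduals by evaluations and for Hilbert spaces by inner products. *)
Definition functionals_separate : Prop := forall y : E,
  (forall psi : {linear E -> R[i]^o}, bounded_map psi -> psi y = 0) -> y = 0.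

(** The condition [n <= h n] sends each tail into itself, so indices chosen independently for each
    [n] qualify. *)
Lemma weakly_converges_subseq (w : nat -> V) l (h : nat -> nat) :
  (forall n, (n <= h n)%N) -> weakly_converges w l ->
  weakly_converges (w \o h) l.
Proof.
move=> nh wl phi phib; apply: cvg_comp (wl phi phib) => A [N _ NA].
by exists N => // n Nn; apply: NA; exact: leq_trans Nn (nh n).
Qed.

(** Otherwise some reindexed images stay at distance [e] from 0. By compactness they have a cluster
    point [y]; weak convergence makes every bounded functional vanish at [y], so [y = 0], a
    contradiction. *)
Lemma compact_operator_weakly_null (K : {linear V -> E}) (w : nat -> V) :
  functionals_separate -> compact_operator K -> weakly_converges w 0 ->
  (forall n, rnorm (w n) <= 1) -> K (w n) @[n --> \oo] --> (0 : E).
Proof.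
move=> sep [[C KC] [B KB [cB _]]] w0 w1.
apply/cvg0_rnormP => e e0; apply: contrapT => nK.
have big n : exists m, (n <= m)%N /\ e <= rnorm (K (w m)).
  apply: contrapT => nm; apply: nK; exists n => // m /= nm'.
  by rewrite ltNge; apply/negP => em; apply: nm; exists m.
have [h hP] := choice big.
have v0 := weakly_converges_subseq (fun n => (hP n).1) w0.
have [] := cB ((K \o (w \o h)) n @[n --> \oo]) _ _.
  by exists 0%N => // n _ /=; apply: KB; exists (w (h n)) => //; exact: w1.
move=> y [_ ycl]; have y0 : y = 0.
  apply: sep => psi [M psiM].
  apply/rnorm_eq0/le_anti; rewrite rnorm_ge0 andbT; apply/ler_addgt0Pr => d d0.
  rewrite add0r.
  have bcomp : bounded_map (psi \o K).
    exists (`|M| * C) => u /=; apply: le_trans (psiM _) _.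
    apply: le_trans (ler_wpM2r (rnorm_ge0 _) (ler_norm M)) _.
    by rewrite -mulrA ler_wpM2l.
  have := v0 (psi \o K) bcomp; rewrite linear0 => /cvg0_rnormP/(_ (d / 2)).
  rewrite divr_gt0 // => /(_ isT) small.
  have Mp : 0 < `|M| + 1 by rewrite ltr_wpDl.
  (* Splits [psi y] as [psi z + psi (y - z)], each part at most [d / 2]; adding 1 to [|M|] keeps the
     divisor positive. *)
  have r0 : 0 < d / 2 / (`|M| + 1) by rewrite !divr_gt0.
  have r0C : 0 < (d / 2 / (`|M| + 1))%:C :> R[i] by rewrite ltcR.
  have [z [/= zsmall zy]] := ycl [set z | rnorm (psi z) < d / 2]
    (ball y (d / 2 / (`|M| + 1))%:C) small (nbhsx_ballx _ _ r0C).
  move: zy; rewrite -ball_normE /= rnormE ltcR => zy.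
  rewrite -(subrK z y) linearD /=; apply: le_trans (rnormD _ _) _.
  rewrite [leRHS]splitr lerD //; last exact: ltW.
  apply: le_trans (psiM _) _.
  apply: le_trans (_ : (`|M| + 1) * rnorm (y - z) <= _).
    by rewrite ler_wpM2r ?rnorm_ge0 // (le_trans (ler_norm M)) // lerDl.
  by rewrite mulrC -ler_pdivlMr // ltW.
have e0C : 0 < e%:C :> R[i] by rewrite ltcR.
have [] := ycl [set z | e <= rnorm z] (ball y e%:C) _ (nbhsx_ballx _ _ e0C).
  by exists 0%N => // n _ /=; exact: (hP n).2.
move=> z [/= ez]; rewrite y0 -ball_normE /= sub0r normrN rnormE ltcR.
by rewrite ltNge ez.
Qed.

End Compactness.

(** * From perturbed coercivity to essential positive-coercivity *)

Section Perturbation.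
Variables (R : realType) (V : normedModType R[i]) (a : sesquilinear_form R V).

Lemma weakly_converges_shrink (u : nat -> V) (c : nat -> R) :
  (forall n, 0 <= c n <= 1) -> weakly_converges u 0 ->
  weakly_converges (fun n => (c n)%:C *: u n) 0.
Proof.
move=> c01 u0 phi phib; rewrite linear0; apply/cvg0_rnormP => e e0.
have := u0 phi phib; rewrite linear0 => /cvg0_rnormP/(_ e e0).
apply: filterS => n; apply: le_lt_trans; have /andP[c0 c1] := c01 n.
rewrite linearZ /= rnormZ ger0_norm ?lecR //=.
by rewrite ler_piMl ?rnorm_ge0.
Qed.

(* [u n] is replaced by [u n / max 1 (rnorm (u n))], so that only bounded
   sequences have to be considered and the uniform boundedness principle is not
   needed. *)
Lemma perturbation_essentially_positive_coercive (b : V -> R) (alpha : R) :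
  0 < alpha ->
  (forall u, alpha * rnorm u ^+ 2 <= complex.Re (a u u) + b u) ->
  (forall w, weakly_converges w 0 -> (forall n, rnorm (w n) <= 1) ->
     forall e : R, 0 < e -> \forall n \near \oo, b (w n) < e) ->
  essentially_positive_coercive a.
Proof.
move=> alpha0 ab bw u u0 /limn_esup_le0P ua.
pose m n := Num.max 1 (rnorm (u n)).
have m1 n : 1 <= m n by rewrite le_max lexx.
have m0 n : 0 < m n by apply: lt_le_trans (m1 n).
have c01 n : 0 <= (m n)^-1 <= 1.
  by rewrite invr_ge0 (ltW (m0 n)) invf_le1 ?m1 ?m0.
pose w n := (m n)^-1%:C *: u n.
have w0 : weakly_converges w 0 by exact: weakly_converges_shrink.
have wE n : rnorm (w n) = (m n)^-1 * rnorm (u n).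
  by rewrite rnormZ ger0_norm ?lecR ?invr_ge0 ?(ltW (m0 n)).
have w1 n : rnorm (w n) <= 1.
  by rewrite wE mulrC ler_pdivrMr // mul1r le_max lexx orbT.
(* Shrinking multiplies the real part by a factor in [[0, 1]]: negative values stay nonpositive and
   the others do not grow. *)
have wa e : 0 < e -> \forall n \near \oo, complex.Re (a (w n) (w n)) < e.
  move=> e0; apply: filterS (ua e e0) => n uae.
  rewrite form_scale ReZr; have /andP[c0 c1] := c01 n.
  have [neg|pos] := ltP (complex.Re (a (u n) (u n))) 0.
    by apply: le_lt_trans e0; rewrite mulr_ge0_le0 ?mulr_ge0 ?(ltW neg).
  by apply: le_lt_trans uae; rewrite ler_piMl // mulr_ile1.
apply/cvg0_ge0P => [n|e e0]; first exact: rnorm_ge0.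
(* Taking [d <= 1] excludes [rnorm (u n) >= 1], where [rnorm (w n) = 1]; in the remaining case
   [w n = u n], and [d <= e] concludes. *)
pose d := Num.min e 1.
have d0 : 0 < d by rewrite lt_min e0 ltr01.
have ad0 : 0 < alpha * d ^+ 2 / 2 by rewrite divr_gt0 // mulr_gt0 // exprn_gt0.
near=> n.
have wad : complex.Re (a (w n) (w n)) < alpha * d ^+ 2 / 2.
  by near: n; exact: wa.
have wbd : b (w n) < alpha * d ^+ 2 / 2 by near: n; exact: bw.
have wd : rnorm (w n) < d.
  rewrite -(ltr_pXn2r (ltn0Sn 1)) ?nnegrE ?rnorm_ge0 ?(ltW d0) //.
  rewrite -(ltr_pM2l alpha0); apply: le_lt_trans (ab _) _.
  by rewrite [ltRHS]splitr ltrD.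
have [u1|u1] := ltP (rnorm (u n)) 1.
  move: wd; rewrite wE /m max_l ?(ltW u1) // invr1 mul1r => /lt_le_trans; apply.
  by rewrite ge_min lexx.
move: wd; rewrite wE /m max_r // mulVf ?gt_eqF ?(lt_le_trans ltr01 u1) //.
by rewrite lt_min ltxx andbF.
Unshelve. all: by end_near. Qed.

Lemma antidual_separates : functionals_separate (antidual V).
Proof.
move=> f f0; apply: antidual_ext => v.
exact: (f0 (antidual_eval v) (antidual_eval_bounded v)).
Qed.

(** The coefficients of [K u] on [e] may be unbounded, as [e] may be dependent. The dual family
    replaces them by the values [K u p.1], which are bounded on the unit ball. *)
Lemma finite_rank_compact (K : {linear V -> antidual V}) :
  finite_rank_operator K -> compact_operator K.
Proof.
move=> [[C KC] [n [e rangeE]]].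
have [ps psP] := antidual_dual_family (index_enum 'I_n) e.
apply: (@compact_operator_sum _ _ _ K _ ps (fun u p => K u p.1) snd
  (fun p => `|C| * rnorm p.1)) => [|u|u p u1].
- by exists C.
- have : range K (K u) by exists u.
  by rewrite rangeE => -[c ->]; exact: psP.
- apply: le_trans (antidual_rnorm_le _ _) _; rewrite ler_wpM2r ?rnorm_ge0 //.
  apply: le_trans (KC u) _.
  apply: le_trans (ler_wpM2r (rnorm_ge0 _) (ler_norm C)) _.
  by rewrite ler_piMr.
Qed.

(** On the unit ball, the real part of [K u u] is at most [rnorm (K u)], which tends to 0 along
    weakly null sequences. *)
Lemma compact_antidual_essentially_positive_coercive
    (K : {linear V -> antidual V}) (alpha : R) :
  compact_operator K -> 0 < alpha ->
  (forall u, alpha * rnorm u ^+ 2 <= complex.Re (a u u + K u u)) ->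
  essentially_positive_coercive a.
Proof.
move=> Kc alpha0 aK.
apply: (@perturbation_essentially_positive_coercive
  (fun u => complex.Re (K u u : R[i])) alpha) => // [u|w w0 w1 e e0].
  by rewrite -ReD.
have := compact_operator_weakly_null antidual_separates Kc w0 w1.
move=> /cvg0_rnormP/(_ e e0); apply: filterS => n; apply: le_lt_trans.
apply: le_trans (ler_norm _) _; apply: le_trans (Re_ler_rnorm _) _.
by apply: le_trans (antidual_rnorm_le _ _) _; rewrite ler_piMr ?rnorm_ge0.
Qed.

End Perturbation.

(** * The Riesz map and the operators built from projections *)

Section HilbertOperators.
Variables (R : realType) (V : hilbertType R).

Definition inner_left (y : V) (u : V) : R[i]^o := inner u y.

Lemma inner_left_is_linear y : linear (inner_left y).
Proof. by move=> c u v; rewrite /inner_left linearDl /= innerZl. Qed.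

HB.instance Definition _ y := GRing.isLinear.Build R[i] V R[i]^o _
  (inner_left y) (inner_left_is_linear y).

Lemma hilbert_separates : functionals_separate V.
Proof.
move=> y /(_ (inner_left y)) y0; apply/eqP; rewrite -(dnorm_eq0 inner).
apply/eqP/y0; exists (rnorm y) => u.
by rewrite mulrC; exact: cauchy_schwarz.
Qed.

(** Here [V] is the target space, the [Y] of (v), and the perturbation is [rnorm (K u) ^+ 2]. *)
Lemma compact_hilbert_essentially_positive_coercive (E : normedModType R[i])
    (a : sesquilinear_form R E) (K : {linear E -> V}) (alpha : R) :
  compact_operator K -> 0 < alpha ->
  (forall u, alpha * rnorm u ^+ 2
               <= complex.Re (a u u + (rnorm (K u) ^+ 2)%:C)) ->
  essentially_positive_coercive a.
Proof.
move=> Kc alpha0 aK.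
apply: (@perturbation_essentially_positive_coercive _ _ _
  (fun u => rnorm (K u) ^+ 2) alpha) => // [u|w w0 w1 e e0].
  by apply: le_trans (aK u) _; rewrite ReD.
have := compact_operator_weakly_null hilbert_separates Kc w0 w1.
move=> /cvg0_rnormP/(_ (Num.sqrt e)); rewrite sqrtr_gt0 => /(_ e0).
apply: filterS => n ne.
by rewrite -(sqr_sqrtr (ltW e0)) ltr_pXn2r ?nnegrE ?rnorm_ge0 ?sqrtr_ge0.
Qed.

Lemma inner_antifunctional (w : V) :
  (fun v => inner w v : R[i]^o) \in @is_antifunctional R V.
Proof.
apply/asboolP; split=> [c u v|]; first by rewrite linearDr /= innerZr.
by exists (rnorm w) => v; exact: cauchy_schwarz.
Qed.

(** The Riesz map into the antidual, linear because [inner] is linear in its first argument. *)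
Definition inner_antidual (w : V) : antidual V :=
  Antidual (inner_antifunctional w).

Lemma inner_antidual_is_linear : linear inner_antidual.
Proof.
move=> c u v; apply: antidual_ext => w.
by rewrite [LHS]linearDl /= innerZl.
Qed.

HB.instance Definition _ := GRing.isLinear.Build R[i] V (antidual V) _
  inner_antidual inner_antidual_is_linear.

Lemma rnorm_inner_antidual w : rnorm (inner_antidual w) <= rnorm w.
Proof.
apply: antidual_norm_le => v v1.
by apply: le_trans (cauchy_schwarz w v) _; rewrite ler_piMr ?rnorm_ge0.
Qed.

(** Used with [c = lam] for (iii), after the Riesz map, and with [c = sqrt lam] for (v). *)
Definition scaled_proj (c : R) (s : seq V) (u : V) : V := c%:C *: proj s u.

Lemma scaled_proj_is_linear c s : linear (scaled_proj c s).
Proof.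
move=> d u v; rewrite /scaled_proj linearP scalerDr !scalerA.
by rewrite (mulrC c%:C).
Qed.

HB.instance Definition _ c s := GRing.isLinear.Build R[i] V V _
  (scaled_proj c s) (scaled_proj_is_linear c s).

Section ScaledProj.
Variables (c : R) (s : seq V).
Hypotheses (c0 : 0 <= c) (s_on : orthonormal inner s).

Lemma rnorm_scaled_proj u : rnorm (scaled_proj c s u) = c * rnorm (proj s u).
Proof. by rewrite rnormZ ger0_norm ?lecR. Qed.

Lemma scaled_proj_bounded : bounded_map (scaled_proj c s).
Proof.
by exists c => u; rewrite rnorm_scaled_proj ler_wpM2l // rnorm_proj_le.
Qed.

Lemma scaled_proj_compact : compact_operator (scaled_proj c s).
Proof.
apply: (@compact_operator_sum _ _ _ _ _ s
  (fun u e => c%:C *: (inner u e : R[i]^o)) id (fun e => c * rnorm e)).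
- exact: scaled_proj_bounded.
- move=> u; rewrite /= /scaled_proj /proj scaler_sumr.
  by apply: eq_bigr => e _; rewrite scalerA.
- move=> u e u1; rewrite rnormZ ger0_norm ?lecR //= ler_wpM2l //.
  by apply: le_trans (cauchy_schwarz u e) _; rewrite ler_piMl ?rnorm_ge0.
Qed.

Lemma scaled_proj_antidual_finite_rank :
  0 < c -> finite_rank_operator (inner_antidual \o scaled_proj c s).
Proof.
move=> cgt0; split.
  have [M PM] := scaled_proj_bounded; exists M => u.
  exact: le_trans (rnorm_inner_antidual _) (PM u).
exists (size s), (fun i => inner_antidual s`_i); apply/seteqP; split.
  move=> _ [u _ <-] /=; exists (fun i : 'I__ => c%:C * inner u s`_i).
  rewrite /scaled_proj /proj scaler_sumr (big_nth 0) big_mkord linear_sum.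
  by apply: eq_bigr => i _; rewrite scalerA linearZ.
(* The range must equal the whole span, so each combination gets a preimage in the span of [s],
   divided by [c]. *)
move=> _ [d ->]; exists (\sum_(i < size s) (c^-1%:C * d i) *: s`_i) => //=.
rewrite linear_sum /= linear_sum; apply: eq_bigr => i _.
rewrite linearZ linearZ /= /scaled_proj (proj_id s_on) ?mem_nth //.
by rewrite linearZ scalerA mulrA -rmorphM /= mulfV ?mul1r // gt_eqF.
Qed.

End ScaledProj.

End HilbertOperators.

(** * Coercivity in finite codimension: from (i), and towards (iii) and (v) *)

Section Coercivity.
Variables (R : realType) (V : hilbertType R) (a : sesquilinear_form R V).

Lemma bounded_sums_cvg0 (x : nat -> R) (M : R) :
  (forall n, 0 <= x n) -> (forall n, \sum_(i < n) x i <= M) ->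
  x n @[n --> \oo] --> (0 : R).
Proof.
move=> x0 xM; apply: cvg_series_cvg_0; apply: nondecreasing_is_cvgn.
  by apply: nondecreasing_series => n _ _; exact: x0.
by exists M => _ [n _ <-]; rewrite /series /= big_mkord; exact: xM.
Qed.

Lemma orthogonal_complement_span (n : nat) (e : 'I_n -> V) u :
  orthogonal_complement
    [set v | exists c : 'I_n -> R[i], v = \sum_(i < n) c i *: e i] u <->
  forall i, inner u (e i) = 0.
Proof.
split=> [ue i|ue _ [c ->]].
  apply: ue; exists (fun j => (j == i)%:R).
  rewrite (bigD1 i) //= eqxx scale1r big1 ?addr0 // => j /negPf ->.
  by rewrite scale0r.
by rewrite linear_sumr /= big1 // => i _; rewrite innerZr ue mulr0.
Qed.

Lemma essentially_positive_coercive_finite_codim :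
  essentially_positive_coercive a ->
  exists (V1 : set V) (alpha : R),
    [/\ finite_dim_subspace V1, 0 < alpha &
        forall u, orthogonal_complement V1 u ->
          alpha * rnorm u ^+ 2 <= complex.Re (a u u)].
Proof.
move=> epc; apply: contrapT => not_ii.
(* Otherwise, by normalization, the span of [s] and [alpha = 1 / (size s + 1)] would witness
   (ii). *)
have pick_ex (s : seq V) : exists u, [/\ rnorm u = 1,
    forall e, e \in s -> inner u e = 0 &
    complex.Re (a u u) < (size s).+1%:R^-1].
  apply: contrapT => nu; apply: not_ii.
  exists [set v | exists c : 'I_(size s) -> R[i],
    v = \sum_(i < size s) c i *: s`_i], (size s).+1%:R^-1.
  split; first by exists (size s), (fun i => s`_i).
    by rewrite invr_gt0.
  move=> u /(orthogonal_complement_span (fun i : 'I_(size s) => s`_i)) us.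
  have [->|u0] := eqVneq u 0; first by rewrite linear0l rnorm0 expr0n mulr0.
  rewrite leNgt; apply/negP => au; apply: nu.
  exists ((rnorm u)^-1%:C *: u); split; first exact: rnormZr_unit.
    move=> e /(nthP 0)[i ilt <-].
    by rewrite innerZl (us (Ordinal ilt)) mulr0.
  rewrite form_scale ReZr -expr2 exprVn ltr_pdivrMl ?exprn_gt0 ?rnorm_gt0 //.
  by rewrite mulrC.
have [pick pickP] := choice pick_ex.
(* [s n] holds the first [n] picks, newest first, so that [pick (s n)] is orthogonal to all of
   them. *)
pose s n := iter n (fun t => pick t :: t) [::].
have size_s n : size (s n) = n by elim: n => //= n ->.
have s_on n : orthonormal inner (s n).
  elim: n => // n IH; have [p1 p2 _] := pickP (s n).
  exact: orthonormal_cons.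
pose u n := pick (s n).
have sum_s (F : V -> R) n : \sum_(e <- s n) F e = \sum_(i < n) F (u i).
  elim: n => [|n IH]; first by rewrite big_nil big_ord0.
  by rewrite big_cons IH big_ord_recr addrC.
have u0 : weakly_converges u 0.
  move=> phi [M phiM]; rewrite linear0; apply/cvg0_rnormP => e e0.
  have : rnorm (phi (u n)) ^+ 2 @[n --> \oo] --> (0 : R).
    apply: (@bounded_sums_cvg0 _ (M ^+ 2)) => n; first exact: sqr_ge0.
    have := bessel_functional (s_on n) phiM.
    by rewrite (sum_s (fun v => rnorm (phi v) ^+ 2)).
  move=> /(cvg0_ge0P (fun n => sqr_ge0 _))/(_ (e ^+ 2)).
  rewrite exprn_gt0 // => /(_ isT); apply: filterS => n.
  by rewrite ltr_pXn2r ?nnegrE ?rnorm_ge0 ?(ltW e0).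
have /(epc u u0) :
    (limn_esup (fun n => (complex.Re (a (u n) (u n)))%:E) <= 0)%E.
  apply/limn_esup_le0P => e e0; near=> n.
  have [_ _ au] := pickP (s n); apply: lt_trans au _; rewrite size_s.
  by near: n; exact: near_infty_natSinv_lt (PosNum e0).
(* Tolerance 1 already contradicts the unit norm of the picks. *)
move=> /(cvg0_ge0P (fun n => rnorm_ge0 _))/(_ 1 ltr01)[N _ /(_ N (leqnn N))] /=.
by have [-> _ _] := pickP (s N); rewrite ltxx.
Unshelve. all: by end_near. Qed.

Lemma finite_codim_coercive_proj :
  continuous_form a ->
  (exists (V1 : set V) (alpha : R),
    [/\ finite_dim_subspace V1, 0 < alpha &
        forall u, orthogonal_complement V1 u ->
          alpha * rnorm u ^+ 2 <= complex.Re (a u u)]) ->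
  exists (s : seq V) (lam alpha : R),
    [/\ orthonormal inner s, 0 < lam, 0 < alpha &
        forall u, alpha * rnorm u ^+ 2
          <= complex.Re (a u u) + lam * rnorm (proj s u) ^+ 2].
Proof.
move=> /continuous_form_bounded[M M0 aM].
move=> [V1 [alpha [[n [e ->]] alpha0 ae]]].
have [s s_on sP] := gram_schmidt [seq e i | i <- enum 'I_n].
(* With [x = |P u|] and [y = |u - P u|], the cross terms cost [2 M x y], at most
   [alpha / 2 * y^2 + 2 M^2 / alpha * x^2] by Young; [M] absorbs [a p p], and [alpha / 2] is the
   coercivity left in [x]. *)
exists s, (alpha / 2 + M + 2 * M ^+ 2 / alpha), (alpha / 2).
have a20 : 0 < alpha / 2 by rewrite divr_gt0.
split=> // [|u].
  by rewrite ltr_wpDr ?ltr_wpDr // divr_ge0 ?mulr_ge0 ?sqr_ge0 // ltW.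
pose p := proj s u; pose q := u - p.
have aq : alpha * rnorm q ^+ 2 <= complex.Re (a q q).
  apply/ae/orthogonal_complement_span => i.
  apply: sP; first exact: proj_compl_orthogonal.
  by rewrite map_f ?mem_enum.
have lower x y : - (M * rnorm x * rnorm y) <= complex.Re (a x y).
  rewrite lerNl; apply: le_trans (aM x y); apply: le_trans (Re_ler_rnorm _).
  by rewrite -normrN ler_norm.
have -> : a u u = a q q + a p q + (a q p + a p p).
  by rewrite -[in LHS](subrK p u) -/q linearDl !linearDr /= addrACA.
rewrite !ReD (rnorm_sqr_proj s_on u) -/p -/q.
move: (lower p q) (lower q p) (lower p p) aq.
move: (complex.Re _) (complex.Re _) (complex.Re _) (complex.Re _).
move: (rnorm p) (rnorm q) => x y app' aqp' apq' aqq' h1 h2 h3 h4.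
have sq : 0 <= alpha / 2 * (y - 2 * M * x / alpha) ^+ 2.
  by rewrite mulr_ge0 ?sqr_ge0 // ltW.
have sqE : alpha / 2 * (y - 2 * M * x / alpha) ^+ 2 =
    alpha / 2 * y ^+ 2 - 2 * M * x * y + 2 * M ^+ 2 / alpha * x ^+ 2.
  by field; rewrite gt_eqF.
rewrite sqE in sq; lra.
Qed.

End Coercivity.

Theorem theorem4p4 (R : realType) (V : hilbertType R)
    (a : sesquilinear_form R V) :
  infinite_dimensional V ->
  continuous_form a ->
  [<-> essentially_positive_coercive a;
       exists (V1 : set V) (alpha : R),
         [/\ finite_dim_subspace V1, 0 < alpha &
             forall u, orthogonal_complement V1 u ->
               alpha * rnorm u ^+ 2 <= Re (a u u)];
       exists (K : {linear V -> antidual V}) (alpha : R),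
         [/\ finite_rank_operator K, 0 < alpha &
             forall u, alpha * rnorm u ^+ 2 <= Re (a u u + K u u)];
       exists (K : {linear V -> antidual V}) (alpha : R),
         [/\ compact_operator K, 0 < alpha &
             forall u, alpha * rnorm u ^+ 2 <= Re (a u u + K u u)];
       exists (Y : hilbertType R) (K : {linear V -> Y}) (alpha : R),
         [/\ compact_operator K, 0 < alpha &
             forall u, alpha * rnorm u ^+ 2
                         <= Re (a u u + (rnorm (K u) ^+ 2)%:C)]].
Proof.
move=> _ ac; split; first exact: essentially_positive_coercive_finite_codim.
split.
  move=> /(finite_codim_coercive_proj ac).
  move=> [s [lam [alpha [s_on lam0 alpha0 aP]]]].
  exists (@inner_antidual R V \o scaled_proj lam s), alpha; split=> // [|u].
    exact: scaled_proj_antidual_finite_rank (ltW lam0) s_on lam0.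
  rewrite ReD /= /scaled_proj innerZl inner_proj_self // ReZr /=; exact: aP.
split.
  move=> [K [alpha [Kf alpha0 aK]]]; exists K, alpha; split=> //.
  exact: finite_rank_compact.
split.
  (* (iv) to (v) passes through (i) and (ii), which replace the given [K] by a multiple of a
     projection. *)
  move=> [K [alpha [Kc alpha0 aK]]].
  have := compact_antidual_essentially_positive_coercive Kc alpha0 aK.
  move=> /essentially_positive_coercive_finite_codim.
  move=> /(finite_codim_coercive_proj ac)[s [lam [beta [s_on lam0 beta0 aP]]]].
  (* The square root makes [rnorm (K u) ^+ 2] equal to [lam * rnorm (proj s u) ^+ 2]. *)
  exists V, (scaled_proj (Num.sqrt lam) s), beta; split=> // [|u].
    exact: scaled_proj_compact (sqrtr_ge0 lam) s_on.
  by rewrite ReD rnorm_scaled_proj ?sqrtr_ge0 // exprMn sqr_sqrtr // ltW.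
move=> [Y [K [alpha [Kc alpha0 aK]]]].
exact: compact_hilbert_essentially_positive_coercive Kc alpha0 aK.
Qed.
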